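(* In the finite-state regularized setting of the context, with regularization parameter $\rho$, suppose $$\bar K+\frac{\bar LK_1}{\rho(1-\beta)}<1.$$ Then the regularized infinite-horizon non-stationary mean-field game with any given initial state-measure $\mu_0\in\mathcal P(X)$ has a unique mean-field equilibrium, and the regularized stationary mean-field game has a unique mean-field equilibrium.
   Context: $X$ and $A$ are finite sets; $\mathcal P(\cdot)$ denotes the set of probability measures; $\|\mu-\nu\|_{\mathrm{TV}}=\frac12\sum_{x}|\mu(x)-\nu(x)|$. Fix $\beta\in[0,1)$, $c:X\times A\times\mathcal P(X)\to\mathbb R$ and $p:X\times A\times\mathcal P(X)\to\mathcal P(X)$ such that, with constants $L_1,K_1\ge0$, $\beta K_1<2$, for all $x,\hat x,a,\hat a,\mu,\hat\mu$: $|c(x,a,\mu)-c(\hat x,\hat a,\hat\mu)|\le L_1(1_{\{x\ne\hat x\}}+2\cdot1_{\{a\neq\hat a\}}+2\|\mu-\hat\mu\|_{\mathrm{TV}})$ and $\|p(\cdot|x,a,\mu)-p(\cdot|\hat x,\hat a,\hat\mu)\|_{\mathrm{TV}}\le\frac{K_1}{2}(1_{\{x\ne\hat x\}}+2\cdot 1_{\{a\neq\hat a\}}+2\|\mu-\hat\mu\|_{\mathrm{TV}})$. For $u\in\mathcal P(A)$ put $C(x,u,\mu)=\sum_a c(x,a,\mu)u(a)$, $P(\cdot|x,u,\mu)=\sum_a p(\cdot|x,a,\mu)u(a)$. The regularizer $\Omega:\mathcal P(A)\to\mathbb R$ is continuous and $\rho$-strongly convex with respect to $\|\cdot\|_1$,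 $\rho>0$: $\Omega(su+(1-s)v)\le s\Omega(u)+(1-s)\Omega(v)-\frac{\rho}{2}s(1-s)\|u-v\|_1^2$. Constants: $\bar L=\frac{L_1}{1-\beta K_1/2}$, $\bar K=\frac{3K_1}{2}+\frac{K_1\bar L}{2\rho(1-\beta)}$. Regularized games have action space $\mathcal P(A)$, one-stage cost $C+\Omega$ and kernel $P$. For a flow $\boldsymbol\mu=(\mu_t)_{t\ge0}$ in $\mathcal P(X)$ there is a unique uniformly bounded sequence $(Q_t)_{t\ge0}$ of functions on $X\times\mathcal P(A)$ with $Q_t(x,u)=C(x,u,\mu_t)+\Omega(u)+\beta\sum_y\min_{b\in\mathcal P(A)}Q_{t+1}(y,b)P(y|x,u,\mu_t)$; each $Q_t(x,\cdot)$ has a unique minimizer $f_t(x)$, and the optimal policy at time $t$ against $\boldsymbol\mu$ is $\pi_t(\cdot|x)=\delta_{f_t(x)}$. A mean-field equilibrium of the non-stationary game with initial measure $\mu_0$ is a pair $((\pi_t)_{t\ge0},(\mu_t)_{t\ge0})$, with first state measure $\mu_0$, such that $\pi_t(\cdot|x)=\delta_{f_t(x)}$ for all $t,x$ and $\mu_{t+1}=\sum_xP(\cdot|x,f_t(x),\mu_t)\mu_t(x)$ for all $t\ge0$. A mean-field equilibrium of the stationary game is a pair $(\pi,\mu)$ such that the constant sequences $(\pi,\pi,\dots)$, $(\mu,\mu,\dots)$ form a mean-field equilibrium of the non-stationary game with initial measure $\mu$. *)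

(* Defs.v *)
From HB Require Import structures.
From mathcomp Require Import all_boot all_order all_algebra.
From mathcomp Require Import all_classical all_reals all_analysis.

Set Implicit Arguments.
Unset Strict Implicit.
Unset Printing Implicit Defensive.

Import Order.TTheory GRing.Theory Num.Theory.
Import numFieldNormedType.Exports.

Local Open Scope classical_set_scope.
Local Open Scope ring_scope.

(* Nonempty finite sets. The distinguished point only witnesses nonemptiness;
   without it P(X) or P(A) is empty and no equilibrium exists. *)
#[short(type="pfinType")]
HB.structure Definition PointedFinite := {T of Finite T & isPointed T}.

Definition pfin_of (T : finType) (x : T) : pfinType :=
  HB.pack T (isPointed.Build T x).

(* P(T) for finite T, each measure being given by its mass function. *)
Section Simplex.
Variables (R : realType) (T : finType).

Record simplex := Simplex {
  mass :> {ffun T -> R};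
  _ : [forall x, 0 <= mass x] && (\sum_x mass x == 1) }.

HB.instance Definition _ := [isSub for mass].
HB.instance Definition _ := [Choice of simplex by <:].

(* The topology P(T) inherits from R^T. *)
HB.instance Definition _ := Topological.copy simplex
  (initial_topology (fun mu : simplex => (mu : T -> R) : {ptws T -> R})).

Lemma simplex_ge0 (mu : simplex) x : 0 <= mu x.
Proof. by case: mu => m /= /andP[/forallP]. Qed.

Lemma simplex_sum (mu : simplex) : \sum_x mu x = 1.
Proof. by case: mu => m /= /andP[_ /eqP]. Qed.

Definition dist_l1 (mu nu : simplex) : R := \sum_x `|mu x - nu x|.

Definition dist_tv (mu nu : simplex) : R := 2^-1 * \sum_x `|mu x - nu x|.

Lemma conv_proof (s : R) (hs : 0 <= s <= 1) (u v : simplex) :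
  let f := [ffun x => s * u x + (1 - s) * v x] in
  [forall x, 0 <= f x] && (\sum_x f x == 1).
Proof.
case/andP: hs => s0 s1 /=; apply/andP; split.
  by apply/forallP => x; rewrite ffunE addr_ge0// mulr_ge0 ?simplex_ge0 ?subr_ge0.
under eq_bigr do rewrite ffunE.
by rewrite big_split /= -!mulr_sumr !simplex_sum !mulr1 addrC subrK.
Qed.

Definition conv (s : R) (hs : 0 <= s <= 1) (u v : simplex) : simplex :=
  Simplex (conv_proof hs u v).

Definition strongly_convex (rho : R) (Omega : simplex -> R) : Prop :=
  forall (s : R) (hs : 0 <= s <= 1) (u v : simplex),
    Omega (conv hs u v) <= s * Omega u + (1 - s) * Omega v
      - rho / 2 * s * (1 - s) * dist_l1 u v ^+ 2.

End Simplex.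

Section Mixture.
Variables (R : realType) (I T : finType).

Lemma mixture_proof (k : I -> simplex R T) (w : simplex R I) :
  let f := [ffun y => \sum_i k i y * w i] in
  [forall y, 0 <= f y] && (\sum_y f y == 1).
Proof.
apply/andP; split.
  by apply/forallP => y; rewrite ffunE sumr_ge0// => i _; rewrite mulr_ge0 ?simplex_ge0.
under eq_bigr do rewrite ffunE.
rewrite exchange_big /=.
under eq_bigr do rewrite -mulr_suml simplex_sum mul1r.
by rewrite simplex_sum.
Qed.

(* mixture k w = \sum_i k(.|i) w(i) *)
Definition mixture (k : I -> simplex R T) (w : simplex R I) : simplex R T :=
  Simplex (mixture_proof k w).

End Mixture.

Section Point.
Variables (R : realType) (T : pfinType).

Lemma point_proof :
  let f := [ffun x : T => (x == point)%:R : R] in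
  [forall x, 0 <= f x] && (\sum_x f x == 1).
Proof.
apply/andP; split; first by apply/forallP => x; rewrite ffunE.
under eq_bigr do rewrite ffunE.
rewrite (bigD1 point)//= eqxx big1 ?addr0// => i /negPf ->.
by [].
Qed.

HB.instance Definition _ := isPointed.Build (simplex R T) (Simplex point_proof).

End Point.

Section Game.
Variables (R : realType) (X A : pfinType).

(* P(A) with its Borel sigma-algebra: the action space of the regularized game. *)
Definition action := g_sigma_algebraType (@open (simplex R A)).

Definition policy := X -> probability action R.

Definition flow := nat -> simplex R X.

(* 1_{x <> x'} + 2 * 1_{a <> a'} + 2 * ||mu - mu'||_TV *)
Definition dist_xam (x x' : X) (a a' : A) (mu mu' : simplex R X) : R :=
  (x != x')%:R + 2 * (a != a')%:R + 2 * dist_tv mu mu'.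

Variables (beta : R) (c : X -> A -> simplex R X -> R)
  (p : X -> A -> simplex R X -> simplex R X) (Omega : simplex R A -> R).

Definition mean_cost (x : X) (u : simplex R A) (mu : simplex R X) : R :=
  \sum_a c x a mu * u a.

Definition mean_kernel (x : X) (u : simplex R A) (mu : simplex R X) :
    simplex R X :=
  mixture (fun a => p x a mu) u.

Definition is_min (S : set R) (m : R) : Prop := S m /\ lbound S m.

(* Q is the uniformly bounded solution of the optimality equations against mu;
   V t y is min_b Q t y b. *)
Definition is_optimalQ (mu : flow) (Q : nat -> X -> simplex R A -> R) : Prop :=
  (exists M : R, forall t x u, `|Q t x u| <= M) /\
  exists V : nat -> X -> R,
    (forall t y, is_min (range (Q t y)) (V t y)) /\
    (forall t x u, Q t x u = mean_cost x u (mu t) + Omega u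
       + beta * \sum_y V t.+1 y * mean_kernel x u (mu t) y).

(* Under the standing assumptions Q and the minimizers f t x are unique, so
   quantifying them existentially is the same as referring to them. *)
Definition is_mfe (mu0 : simplex R X) (pi : nat -> policy) (mu : flow) : Prop :=
  mu 0%N = mu0 /\
  exists (Q : nat -> X -> simplex R A -> R) (f : nat -> X -> simplex R A),
    [/\ is_optimalQ mu Q,
        forall t x u, Q t x (f t x) <= Q t x u,
        forall t x, pi t x = \d_(f t x : action) :> probability action R
      & forall t, mu t.+1 = mixture (fun x => mean_kernel x (f t x) (mu t)) (mu t)].

Definition is_stationary_mfe (pi : policy) (mu : simplex R X) : Prop :=
  is_mfe mu (fun=> pi) (fun=> mu).

End Game.

Section Constants.
Variable R : realType.

Definition Lbar (beta L1 K1 : R) : R := L1 / (1 - beta * K1 / 2).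

Definition Kbar (beta L1 K1 rho : R) : R :=
  3 * K1 / 2 + K1 * Lbar beta L1 K1 / (2 * rho * (1 - beta)).

End Constants.

(* Main.v *)
Require Import Defs.
From HB Require Import structures.
From mathcomp Require Import all_boot all_order all_algebra.
From mathcomp Require Import all_classical all_reals all_analysis.
From mathcomp Require Import ring lra.

Set Implicit Arguments.
Unset Strict Implicit.
Unset Printing Implicit Defensive.

Import Order.TTheory GRing.Theory Num.Theory.
Import numFieldNormedType.Exports.

Local Open Scope classical_set_scope.
Local Open Scope ring_scope.

(* For a flow [mu], the optimal values [V t] solve a Bellman equation that is a
   [beta]-contraction in sup norm.  Iterating the Lipschitz bounds on the data
   gives oscillation at most [Lbar] for [V t], and [Lbar / (1 - beta)] as
   Lipschitz constant of [V] in the flow.  The objective minimized at time [t]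
   is [Omega] plus a linear form, so by strong convexity its unique minimizer
   moves by at most [1 / rho] times the sup-norm change of that form.  Hence
   the map sending a flow to the state measures generated by the best responses
   to it contracts the metric [sup_t ||mu t - mu' t||_1], with a constant at
   most the left-hand side of the smallness condition (through
   [1 <= 1 / (1 - beta)]).  Its fixed points are the equilibria; the constant
   flows give the stationary ones. *)

(** * Suprema, geometric completeness and fixed points of contractions *)

Section Contraction.
Variable R : realType.

(** Apply the step to the supremum [s], which gives [s <= e + k * s]. The a priori bound [M] makes
    [s] finite and leaves no trace in the conclusion. *)
Lemma affine_bound (I : Type) (a : I -> R) (M e k : R) : k < 1 ->
  (forall i, a i <= M) ->
  (forall d, (forall i, a i <= d) -> forall i, a i <= e + k * d) ->
  forall i, a i <= e / (1 - k).
Proof.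
move=> k1 aM step i0.
have rng0 : range a !=set0 by exists (a i0); exists i0.
have hs : has_sup (range a) by split=> //; exists M => _ [i _ <-].
set s := sup (range a).
have as_ i : a i <= s by apply: ub_le_sup; [exact: hs.2 | exists i].
have : s <= e + k * s by apply: ge_sup => // _ [i _ <-]; exact: step.
move=> se; rewrite (le_trans (as_ i0))// ler_pdivlMr ?subr_gt0//; lra.
Qed.

Lemma le_geometric0 (x C k : R) : 0 <= k < 1 ->
  (forall n, x <= C * k ^+ n) -> x <= 0.
Proof.
move=> /andP[k0 k1] H.
have : geometric C k @ \oo --> (0 : R).
  by apply: cvg_geometric; rewrite ger0_norm.
by move=> h; apply: (cvgr_to_ge h); apply: nearW.
Qed.

(* The [C'] below must not depend on the sequence: it is applied to all the
   coordinates of a sequence of functions at once. *)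
Definition geometrically_complete (E : Type) (dist : E -> E -> R) : Prop :=
  forall C k, 0 <= k < 1 -> exists C', forall u : nat -> E,
    (forall n, dist (u n) (u n.+1) <= C * k ^+ n) ->
    exists l, forall n, dist (u n) l <= C' * k ^+ n.

(* The limit is squeezed between the nondecreasing sequence
   [u n - C k^n / (1 - k)] and the nonincreasing [u n + C k^n / (1 - k)]. *)
Lemma real_geometrically_complete :
  geometrically_complete (fun x y : R => `|x - y|).
Proof.
move=> C k /andP[k0 k1]; exists (C / (1 - k)) => u hu.
have k10 : 1 - k != 0 by rewrite subr_eq0 gt_eqF.
pose g n := C / (1 - k) * k ^+ n.
have gS n : g n - g n.+1 = C * k ^+ n by rewrite /g exprS; field.
have g0 n : 0 <= g n.
  have C0 : 0 <= C by have := hu 0%N; rewrite expr0 mulr1; exact: le_trans.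
  by rewrite mulr_ge0 ?exprn_ge0 ?divr_ge0 ?subr_ge0 ?(ltW k1).
have up : nondecreasing_seq (fun n => u n - g n).
  apply/nondecreasing_seqP => n; have := hu n.
  by rewrite -gS ler_norml => /andP[? ?] /=; lra.
have dn : nonincreasing_seq (fun n => u n + g n).
  apply/nonincreasing_seqP => n; have := hu n.
  by rewrite -gS ler_norml => /andP[? ?] /=; lra.
have sep n m : u n - g n <= u m + g m.
  have := up _ _ (leq_maxl n m); have := dn _ _ (leq_maxr n m).
  by have := g0 (maxn n m); move=> ? ? ? /=; lra.
pose l := sup (range (fun n => u n - g n)).
have lel n : u n - g n <= l.
  apply: ub_le_sup; last by exists n.
  by exists (u 0%N + g 0%N) => _ [m _ <-].
have leu n : l <= u n + g n.
  by apply: ge_sup; [exists (u 0%N - g 0%N); exists 0%N | move=> _ [m _ <-]].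
exists l => n; have := lel n; have := leu n; rewrite ler_norml -/(g n) => ? ?.
by apply/andP; split; lra.
Qed.

(** Coordinates converge by the real case, and summing over [T] costs the factor [#|T|].
    Nonnegativity and total mass [1] pass to the limit because the errors decay geometrically. *)
Lemma simplex_geometrically_complete (T : finType) :
  geometrically_complete (@dist_l1 R T).
Proof.
move=> C k k01.
have [C' HC'] := real_geometrically_complete C k01.
exists (#|T|%:R * C') => u hu.
have coord x : exists lx, forall n, `|u n x - lx| <= C' * k ^+ n.
  apply: (HC' (fun n => u n x)) => n; apply: le_trans (hu n).
  by rewrite /dist_l1 (bigD1 x)//= lerDl sumr_ge0.
have [l hl] := choice coord.
have sumle n : \sum_x `|u n x - l x| <= #|T|%:R * C' * k ^+ n.
  rewrite (le_trans (ler_sum _ (fun x _ => hl x n)))//.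
  by rewrite sumr_const -mulrA mulr_natl.
have hm : [forall x, 0 <= [ffun x => l x] x] && (\sum_x [ffun x => l x] x == 1).
  apply/andP; split.
    apply/forallP => x; rewrite ffunE -oppr_le0.
    apply: (@le_geometric0 _ C' k) => // n.
    have := hl x n; have := simplex_ge0 (u n) x.
    by rewrite ler_norml => ? /andP[? ?]; lra.
  rewrite -subr_eq0 -normr_le0; under eq_bigr do rewrite ffunE.
  apply: (@le_geometric0 _ (#|T|%:R * C') k) => // n; apply: le_trans (sumle n).
  rewrite -(simplex_sum (u n)) -sumrB (le_trans (ler_norm_sum _ _ _))//.
  by apply: ler_sum => x _; rewrite distrC.
exists (Simplex hm) => n; apply: le_trans (sumle n).
by apply: ler_sum => x _ /=; rewrite ffunE.
Qed.

(** * Banach's theorem on families [I -> E], phrased with uniform bounds because the sup distance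
    may be infinite *)

Section FixedPoint.
Variables (I E : Type) (dist : E -> E -> R).
Hypothesis dist_sym : forall x y, dist x y = dist y x.
Hypothesis dist_triangle : forall x y z, dist x z <= dist x y + dist y z.
Hypothesis dist_sep : forall x y, dist x y <= 0 -> x = y.
Variables (H : (I -> E) -> I -> E) (k : R).
Hypothesis k01 : 0 <= k < 1.
Hypothesis H_lip : forall u v d, (forall i, dist (u i) (v i) <= d) ->
  forall i, dist (H u i) (H v i) <= k * d.

Lemma contraction_unique (u v : I -> E) (M : R) :
  (forall i, dist (u i) (v i) <= M) -> H u = u -> H v = v -> u = v.
Proof.
move=> bd Hu Hv; apply/funext => i; apply: dist_sep.
case/andP: k01 => _ k1.
have := @affine_bound _ (fun i => dist (u i) (v i)) M 0 k k1 bd.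
rewrite mul0r; apply => d hd j.
by rewrite add0r -[in leLHS]Hu -[in leLHS]Hv; exact: H_lip.
Qed.

(** Picard iteration from [u0]. The bound on the distance from [u0] to the fixed point is kept so
    that value functions inherit boundedness. *)
Lemma contraction_exists (u0 : I -> E) (M : R) : geometrically_complete dist ->
  (forall i, dist (u0 i) (H u0 i) <= M) ->
  exists u, H u = u /\ exists M', forall i, dist (u0 i) (u i) <= M'.
Proof.
move=> compl bd0; pose w n := iter n H u0.
have step n i : dist (w n i) (w n.+1 i) <= M * k ^+ n.
  elim: n i => [i|n ih i]; first by rewrite mulr1; exact: bd0.
  by rewrite exprS mulrCA; apply: H_lip.
have [C' HC'] := compl M k k01.
have /choice[l hl] : forall i, exists li, forall n, dist (w n i) li <= C' * k ^+ n.
  by move=> i; apply: (HC' (fun n => w n i)).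
exists l; split; last by exists (C' * k ^+ 0) => i; exact: (hl i 0%N).
apply/funext => i; apply: dist_sep.
(* Both [H l] and [l] are within [C' * k ^+ n.+1] of the iterate [w n.+1]. *)
apply: (@le_geometric0 _ (2 * (C' * k)) k) => // n.
apply: le_trans (dist_triangle _ (w n.+1 i) _) _.
rewrite dist_sym; have h1 := H_lip (hl^~ n) i.
apply: (le_trans (lerD h1 (hl i n.+1))).
by rewrite exprS le_eqVlt; apply/orP; left; apply/eqP; ring.
Qed.

End FixedPoint.
End Contraction.

(** * The l1 metric on the simplex and bounds on means *)

Section SimplexMetric.
Variables (R : realType) (T : finType).
Implicit Types mu nu : simplex R T.

Lemma simplex_ext mu nu : mu =1 nu -> mu = nu.
Proof. by move=> h; apply/val_inj/ffunP. Qed.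

Lemma simplex_inhabited mu : exists x : T, True.
Proof.
case: (pickP (@predT T)) => [x _|T0]; first by exists x.
have := simplex_sum mu; rewrite big_pred0// => /eqP.
by rewrite eq_sym oner_eq0.
Qed.

Lemma dist_l1E mu nu : dist_l1 mu nu = 2 * dist_tv mu nu.
Proof. by rewrite /dist_tv mulrA divff ?mul1r. Qed.

Lemma dist_l1_ge0 mu nu : 0 <= dist_l1 mu nu.
Proof. exact: sumr_ge0. Qed.

Lemma dist_l1xx mu : dist_l1 mu mu = 0.
Proof. by apply: big1 => x _; rewrite subrr normr0. Qed.

Lemma dist_l1_sym mu nu : dist_l1 mu nu = dist_l1 nu mu.
Proof. by apply: eq_bigr => x _; rewrite distrC. Qed.

Lemma dist_l1_triangle mu nu xi : dist_l1 mu xi <= dist_l1 mu nu + dist_l1 nu xi.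
Proof. by rewrite -big_split; apply: ler_sum => x _; exact: ler_distD. Qed.

Lemma dist_l1_sep mu nu : dist_l1 mu nu <= 0 -> mu = nu.
Proof.
move=> d0; apply: simplex_ext => x; apply/eqP; rewrite -subr_eq0 -normr_eq0.
have /eqP : dist_l1 mu nu = 0 by apply/eqP; rewrite eq_le d0 dist_l1_ge0.
by rewrite psumr_eq0// => /allP /(_ x (mem_index_enum _)).
Qed.

Lemma dist_l1_le2 mu nu : dist_l1 mu nu <= 2.
Proof.
have -> : 2 = \sum_x (mu x + nu x) by rewrite big_split/= !simplex_sum.
apply: ler_sum => x _.
by rewrite (le_trans (ler_normB _ _))// !ger0_norm ?simplex_ge0.
Qed.

Lemma le_mean (g : T -> R) d mu : (forall x, g x <= d) -> \sum_x g x * mu x <= d.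
Proof.
move=> gd; rewrite -[leRHS]mulr1 -(simplex_sum mu) mulr_sumr.
by apply: ler_sum => x _; rewrite ler_wpM2r ?simplex_ge0.
Qed.

Lemma norm_mean_le (g : T -> R) d mu :
  (forall x, `|g x| <= d) -> `|\sum_x g x * mu x| <= d.
Proof.
move=> gd; rewrite (le_trans (ler_norm_sum _ _ _))//.
under eq_bigr => x _ do rewrite normrM (ger0_norm (simplex_ge0 mu x)).
exact: le_mean.
Qed.

(* Since [mu - nu] has total mass [0], [g] may be recentred at the midpoint of
   its range, where [`|g| <= D / 2]. *)
Lemma osc_mean_le (g : T -> R) D mu nu : (forall x y, `|g x - g y| <= D) ->
  `|\sum_x g x * mu x - \sum_x g x * nu x| <= D / 2 * dist_l1 mu nu.
Proof.
move=> osc; have [x0 _] := simplex_inhabited mu.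
have [M _ gM] := arg_maxP g (erefl : predT x0).
have [m _ gm] := arg_minP g (erefl : predT x0).
pose z := (g M + g m) / 2.
have gz x : `|g x - z| <= D / 2.
  have /ler_normlP[_ ?] := osc M m; have := gM x isT; have := gm x isT.
  move=> ? ?; have [? ?] : g x <= g M /\ g m <= g x by [].
  by rewrite ler_norml /z; apply/andP; split; lra.
have -> : \sum_x g x * mu x - \sum_x g x * nu x
    = \sum_x (g x - z) * (mu x - nu x).
  under [RHS]eq_bigr do rewrite mulrBl !mulrBr.
  by rewrite !sumrB -!mulr_sumr !simplex_sum subrr subr0.
rewrite (le_trans (ler_norm_sum _ _ _))// mulr_sumr.
by apply: ler_sum => x _; rewrite normrM ler_wpM2r.
Qed.

End SimplexMetric.

(** * Lipschitz dependence of a mixture on its kernel and on its weights *)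

Section MixtureLipschitz.
Variables (R : realType) (I T : finType).
Implicit Types (k : I -> simplex R T) (w : simplex R I).

Lemma mixture_lipl k k' w d : (forall i, dist_l1 (k i) (k' i) <= d) ->
  dist_l1 (mixture k w) (mixture k' w) <= d.
Proof.
move=> kd.
apply: (@le_trans _ _ (\sum_i dist_l1 (k i) (k' i) * w i)); last exact: le_mean.
under [leRHS]eq_bigr do rewrite mulr_suml.
rewrite exchange_big; apply: ler_sum => y _ /=; rewrite !ffunE -sumrB.
rewrite (le_trans (ler_norm_sum _ _ _))//; apply: ler_sum => i _.
by rewrite -mulrBl normrM (ger0_norm (simplex_ge0 w i)).
Qed.

(* Testing against the sign of the difference reduces to [osc_mean_le]. *)
Lemma mixture_lipr k w w' D : (forall i j, dist_l1 (k i) (k j) <= D) ->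
  dist_l1 (mixture k w) (mixture k w') <= D / 2 * dist_l1 w w'.
Proof.
move=> kD; pose s y := Num.sg (mixture k w y - mixture k w' y).
pose g i := \sum_y s y * k i y.
have gE (v : simplex R I) : \sum_i g i * v i = \sum_y s y * mixture k v y.
  under eq_bigr do rewrite mulr_suml.
  rewrite exchange_big; apply: eq_bigr => y _ /=.
  by rewrite ffunE mulr_sumr; apply: eq_bigr => i _; rewrite mulrA.
have -> : dist_l1 (mixture k w) (mixture k w')
    = \sum_i g i * w i - \sum_i g i * w' i.
  rewrite !gE -sumrB; apply: eq_bigr => y _.
  by rewrite -mulrBr normrEsg.
apply: le_trans (ler_norm _) _; apply: osc_mean_le => i j.
rewrite -sumrB (le_trans (ler_norm_sum _ _ _))// (le_trans _ (kD i j))//.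
apply: ler_sum => y _; rewrite -mulrBr normrM ler_piMl// /s.
by rewrite normr_sg; case: (_ != 0).
Qed.

End MixtureLipschitz.

(** * Compactness of the simplex and continuity of its coordinates *)

Section SimplexCompact.

Lemma cvg_initial (S : choiceType) (T : topologicalType) (f : S -> T)
    (F : set_system S) (s : S) : Filter F ->
  f @ F --> f s -> F --> (s : initial_topology f).
Proof.
move=> FF cvF A /= [_ [[B Bop <-] Bfs sBfA]].
have nB : nbhs (f s) B by apply: open_nbhs_nbhs.
exact: filterS sBfA (cvF _ nB).
Qed.

Lemma ultra_fmap (S T : Type) (f : S -> T) (F : set_system S) :
  UltraFilter F -> UltraFilter (f @ F).
Proof.
move=> FU; split=> [|G PG sFG]; first exact: fmap_proper_filter.
apply/seteqP; split=> // A GA.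
have [//|FnA] := in_ultra_setVsetC (f @^-1` A) FU.
have /filter_ex[x []] : G (A `&` ~` A) by apply: filterI => //; exact: sFG.
by [].
Qed.

Variables (R : realType) (T : finType).

(** Each coordinate pushes an ultrafilter to an ultrafilter on [[0, 1]], which converges; the limits
    again form a mass function. *)
Lemma simplex_compact : compact [set: simplex R T].
Proof.
rewrite compact_ultra => F FU _; have FP : ProperFilter F := ultra_proper.
have /choice[v hv] : forall x, exists v : R,
    (fun mu : simplex R T => mu x) @ F --> v.
  move=> x; have := @segment_compact R 0 1; rewrite compact_ultra.
  move=> /(_ _ (ultra_fmap (fun mu : simplex R T => mu x) FU)) [|v [_ hv]].
    apply: (@filterS _ F _ setT) => [mu _ /=|]; last exact: filterT.
    rewrite in_itv/= simplex_ge0/= -(simplex_sum mu) (bigD1 x)//= lerDl.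
    by apply: sumr_ge0 => y _; exact: simplex_ge0.
  by exists v.
have vE : [forall x, 0 <= [ffun x => v x] x] && (\sum_x [ffun x => v x] x == 1).
  apply/andP; split.
    apply/forallP => x; rewrite ffunE; apply: (cvgr_to_ge (hv x)).
    by apply: nearW => mu; exact: simplex_ge0.
  under eq_bigr do rewrite ffunE.
  have h : (fun mu : simplex R T => \sum_x mu x) @ F --> \sum_x v x.
    by apply: cvg_big => //; exact: add_continuous.
  rewrite eq_le; apply/andP; split.
    by apply: (cvgr_to_le h); apply: nearW => mu; rewrite simplex_sum.
  by apply: (cvgr_to_ge h); apply: nearW => mu; rewrite simplex_sum.
exists (Simplex vE); split=> //=.
(* Two layers of initial topology: first the mass map into the product, then the coordinates, whose
   topologies have the product topology as supremum. *)
apply: cvg_initial; apply/cvg_sup => x; apply: cvg_initial.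
by rewrite /= ffunE; exact: hv.
Qed.

Lemma simplex_eval_continuous (x : T) : continuous (fun mu : simplex R T => mu x).
Proof.
pose phi (nu : simplex R T) : {ptws T -> R} := (nu : T -> R).
have phi_cont : continuous phi.
  exact: (@initial_continuous (simplex R T) {ptws T -> R} phi).
move=> mu; exact: cvg_comp (phi_cont mu) (@proj_continuous _ (fun=> R) x _).
Qed.

End SimplexCompact.

(** * Minimizing [Omega] plus a linear form *)

Section Minimizer.
Variables (R : realType) (A : pfinType) (rho : R) (Omega : simplex R A -> R).
Hypothesis rho_gt0 : 0 < rho.
Hypothesis Omega_cont : continuous Omega.
Hypothesis Omega_conv : strongly_convex rho Omega.
Implicit Types (F G : A -> R) (u v : simplex R A).

Definition objective F u : R := Omega u + \sum_a F a * u a.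

Lemma objective_continuous F : continuous (objective F).
Proof.
have sum_cont : continuous (fun u => \sum_a F a * u a).
  apply: continuous_big => [|a _ u]; first exact: add_continuous.
  exact: cvgMr (@simplex_eval_continuous _ _ a u).
by move=> u; exact: cvgD (@Omega_cont u) (sum_cont u).
Qed.

Lemma simplex_min (f : simplex R A -> R) : continuous f ->
  exists u, forall v, f u <= f v.
Proof.
move=> fc.
have ne : [set: simplex R A] !=set0 by exists point.
have := compact_EVT_min ne (@simplex_compact R A).
move=> /(_ _ f (continuous_subspaceT fc)) [u _ hu].
by exists u => v; apply: hu; rewrite inE.
Qed.

(** Continuity of [Omega] and compactness make the set nonempty, so the choice is a genuine
    minimizer ([minimizerP]). *)
Definition minimizer F : simplex R A :=
  xget point [set u | forall v, objective F u <= objective F v].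

Definition min_value F : R := objective F (minimizer F).

Lemma minimizerP F v : min_value F <= objective F v.
Proof.
have [u hu] := simplex_min (objective_continuous (F := F)).
pose S := [set w | forall v, objective F w <= objective F v].
exact: (xgetPex point (ex_intro S u hu)).
Qed.

(* Minimality against the points [s v + (1 - s) u] gives the bound with
   [(1 - s) rho / 2]; then [s] tends to [0]. *)
Lemma objective_growth F u : (forall v, objective F u <= objective F v) ->
  forall v, objective F u + rho / 2 * dist_l1 u v ^+ 2 <= objective F v.
Proof.
move=> umin v; rewrite -subr_le0.
pose D := dist_l1 v u.
apply: (@le_geometric0 _ _ (rho / 2 * D ^+ 2) 2^-1) => [|n].
  by apply/andP; split; lra.
(* Along these values of [s], letting [s] tend to [0] is an instance of [le_geometric0]. *)
set s : R := 2^-1 ^+ n.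
have s0 : 0 < s by rewrite exprn_gt0// invr_gt0.
have s1 : s <= 1 by rewrite exprn_ile1//; lra.
have hs : 0 <= s <= 1 by rewrite (ltW s0).
have := le_trans (umin (Defs.conv hs v u)) (lerD (Omega_conv hs v u) (lexx _)).
have -> : \sum_a F a * Defs.conv hs v u a
    = s * \sum_a F a * v a + (1 - s) * \sum_a F a * u a.
  rewrite !mulr_sumr -big_split/=; apply: eq_bigr => a _; rewrite ffunE; ring.
rewrite -/D /objective (dist_l1_sym u v) -/D.
set o := Omega u; set o' := Omega v; set x := \sum_a _; set x' := \sum_a _.
move=> h; rewrite -(ler_pM2l s0); lra.
Qed.

Lemma minimizer_unique F u :
  (forall v, objective F u <= objective F v) -> u = minimizer F.
Proof.
move=> umin; apply: dist_l1_sep.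
have := le_trans (objective_growth umin (minimizer F)) (minimizerP F u).
rewrite gerDl pmulr_rle0 ?divr_gt0// => h.
by have /eqP : dist_l1 u (minimizer F) ^+ 2 = 0;
  [apply/eqP; rewrite eq_le h sqr_ge0 | rewrite sqrf_eq0 => /eqP ->].
Qed.

(** Each minimizer serves as a competitor in the other problem. *)
Lemma min_value_close F G d : (forall a, `|F a - G a| <= d) ->
  `|min_value F - min_value G| <= d.
Proof.
have half F' G' : (forall a, `|F' a - G' a| <= d) ->
    min_value F' - min_value G' <= d.
  move=> FG; have := minimizerP F' (minimizer G').
  have := le_trans (ler_norm _) (norm_mean_le (minimizer G') FG).
  under eq_bigr do rewrite mulrBl.
  by rewrite sumrB {3}/min_value /objective; lra.
move=> FG; rewrite ler_norml lerNl opprB; apply/andP; split; apply: half => // a.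
by rewrite distrC.
Qed.

(** Adding the growth inequalities at the two minimizers cancels [Omega] and leaves
    [rho * D ^+ 2 <= d * D], with [D] their distance. *)
Lemma minimizer_lip F G d : (forall a, `|F a - G a| <= d) ->
  dist_l1 (minimizer F) (minimizer G) <= d / rho.
Proof.
move=> FG; set u := minimizer F; set v := minimizer G.
have hF := objective_growth (minimizerP F) v.
have hG := objective_growth (minimizerP G) u.
rewrite -/u -/v in hF hG; rewrite (dist_l1_sym v u) in hG.
set D := dist_l1 u v in hF hG *.
have D0 : 0 <= D := dist_l1_ge0 _ _.
have d0 : 0 <= d := le_trans (normr_ge0 _) (FG point).
have key : rho * D ^+ 2 <= d * D.
  apply: (@le_trans _ _ (\sum_a (F a - G a) * (v a - u a))).
    have -> : \sum_a (F a - G a) * (v a - u a) = \sum_a F a * v a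
        - \sum_a F a * u a - (\sum_a G a * v a - \sum_a G a * u a).
      by rewrite -!sumrB; apply: eq_bigr => a _; ring.
    by move: hF hG; rewrite /objective; lra.
  rewrite /D (dist_l1_sym u v) mulr_sumr; apply: ler_sum => a _.
  by rewrite (le_trans (ler_norm _))// normrM ler_wpM2r.
rewrite ler_pdivlMr//.
have [D_gt0|] := ltP 0 D.
  by rewrite -(ler_pM2r D_gt0); move: key; rewrite expr2; lra.
by move=> Dle; apply: le_trans d0; rewrite pmulr_lle0.
Qed.

End Minimizer.

(** * Regularity of the data of the game *)

Section MeanFieldGame.
Variables (R : realType) (X A : pfinType) (beta L1 K1 rho : R).
Variables (c : X -> A -> simplex R X -> R)
  (p : X -> A -> simplex R X -> simplex R X) (Omega : simplex R A -> R).
Hypothesis hbeta : 0 <= beta < 1.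
Hypothesis hL1 : 0 <= L1.
Hypothesis hK1 : 0 <= K1.
Hypothesis hbetaK1 : beta * K1 < 2.
Hypothesis hc : forall x x' a a' mu mu',
  `|c x a mu - c x' a' mu'| <= L1 * dist_xam x x' a a' mu mu'.
Hypothesis hp : forall x x' a a' mu mu',
  dist_tv (p x a mu) (p x' a' mu') <= K1 / 2 * dist_xam x x' a a' mu mu'.
Hypothesis hrho : 0 < rho.
Hypothesis hOmega_cont : continuous Omega.
Hypothesis hOmega_conv : strongly_convex rho Omega.

Local Notation Lb := (Lbar beta L1 K1).

Let beta_ge0 : 0 <= beta. Proof. by case/andP: hbeta. Qed.
Let beta_lt1 : beta < 1. Proof. by case/andP: hbeta. Qed.
Let beta_neq1 : 1 - beta != 0. Proof. by rewrite subr_eq0 gt_eqF. Qed.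
Let rho_neq0 : rho != 0. Proof. by rewrite gt_eqF. Qed.
Let rate_lt1 : beta * K1 / 2 < 1. Proof. by rewrite ltr_pdivrMr ?mul1r. Qed.

Lemma Lbar_ge0 : 0 <= Lb.
Proof. by rewrite divr_ge0// subr_ge0 ltW. Qed.

(** [Lb] is the fixed point of the map sending an oscillation bound [D] for the next values to the
    constant of [action_value_lip]. *)
Lemma Lbar_fixed : L1 + beta * (K1 / 2 * Lb) = Lb.
Proof.
have h : Lb * (1 - beta * K1 / 2) = L1 by rewrite divfK// subr_eq0 gt_eqF.
by rewrite -[X in X + _ = _]h; ring.
Qed.

Lemma dist_xam_diag (x x' : X) (a : A) (mu mu' : simplex R X) :
  dist_xam x x' a a mu mu' = (x != x')%:R + dist_l1 mu mu'.
Proof. by rewrite /dist_xam eqxx mulr0 addr0 dist_l1E. Qed.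

Lemma cost_bounded : exists M : R, forall x a mu, `|c x a mu| <= M.
Proof.
(* [5 = 1 + 2 + 2] bounds [dist_xam], the last term by [dist_l1_le2]. *)
exists (`|c point point point| + L1 * 5) => x a mu.
rewrite -lerBlDl (le_trans (lerB_dist _ _))// (le_trans (hc _ _ _ _ _ _))//.
apply: ler_wpM2l => //; rewrite /dist_xam -dist_l1E.
have := dist_l1_le2 mu point.
by case: (x != _); case: (a != _); rewrite /= ?mulr1n ?mulr0n; lra.
Qed.

Lemma kernel_lip x x' a mu mu' :
  dist_l1 (p x a mu) (p x' a mu') <= K1 * ((x != x')%:R + dist_l1 mu mu').
Proof.
by rewrite dist_l1E -(dist_xam_diag _ _ a); have := hp x x' a a mu mu'; lra.
Qed.

(** The [2] is the weight of [a != a'] in [dist_xam]; [mixture_lipr] halves it, leaving [K1] in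
    [mean_kernel_lip]. *)
Lemma kernel_osc x a a' mu : dist_l1 (p x a mu) (p x a' mu) <= K1 * 2.
Proof.
rewrite dist_l1E; apply: (@le_trans _ _ (K1 * dist_xam x x a a' mu mu)).
  by have := hp x x a a' mu mu; lra.
apply: ler_wpM2l => //; rewrite /dist_xam -dist_l1E dist_l1xx eqxx.
by case: (a != _); rewrite /= ?mulr1n ?mulr0n; lra.
Qed.

Lemma mean_kernel_lip x x' u u' mu mu' :
  dist_l1 (mean_kernel p x u mu) (mean_kernel p x' u' mu')
    <= K1 * ((x != x')%:R + dist_l1 u u' + dist_l1 mu mu').
Proof.
apply: le_trans (dist_l1_triangle _ (mean_kernel p x u' mu) _) _.
have h1 := mixture_lipr u u' (fun a a' => kernel_osc x a a' mu).
have h2 := mixture_lipl u' (fun a => kernel_lip x x' a mu mu').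
by apply: le_trans (lerD h1 h2) _; lra.
Qed.

Definition action_value (V : X -> R) (x : X) (mu : simplex R X) (a : A) : R :=
  c x a mu + beta * \sum_y V y * p x a mu y.

(** Mean cost and kernel are linear in [u], so the right side of the optimality equation is [Omega]
    plus a linear form, as the minimizer lemmas require. *)
Lemma objective_action_value V x mu u :
  objective Omega (action_value V x mu) u
  = mean_cost c x u mu + Omega u + beta * \sum_y V y * mean_kernel p x u mu y.
Proof.
rewrite /objective /action_value /mean_cost [_ + Omega u]addrC -addrA.
under eq_bigr do rewrite mulrDl.
rewrite big_split/=; congr (_ + (_ + _)).
under eq_bigr do rewrite -mulrA mulr_suml.
rewrite -mulr_sumr exchange_big/=; congr (_ * _); apply: eq_bigr => y _.
by rewrite ffunE mulr_sumr; apply: eq_bigr => a _; rewrite mulrA.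
Qed.

Lemma action_value_close V V' x mu a d : (forall y, `|V y - V' y| <= d) ->
  `|action_value V x mu a - action_value V' x mu a| <= beta * d.
Proof.
move=> VV'; rewrite /action_value opprD addrACA subrr add0r -mulrBr normrM.
rewrite (ger0_norm beta_ge0) ler_wpM2l// -sumrB; under eq_bigr do rewrite -mulrBl.
exact: norm_mean_le.
Qed.

(** Kernels have equal mass, so [V] enters only through its oscillation: the factor [D / 2] of
    [osc_mean_le] meets the [K1] of [kernel_lip]. *)
Lemma action_value_lip V x x' mu mu' a (D : R) :
  (forall y y', `|V y - V y'| <= D) ->
  `|action_value V x mu a - action_value V x' mu' a|
    <= (L1 + beta * (K1 / 2 * D)) * ((x != x')%:R + dist_l1 mu mu').
Proof.
move=> oscV; have D0 : 0 <= D := le_trans (normr_ge0 _) (oscV point point).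
have D20 : 0 <= D / 2 by rewrite divr_ge0.
have h1 := hc x x' a a mu mu'; rewrite dist_xam_diag in h1.
have h2 := osc_mean_le (p x a mu) (p x' a mu') oscV.
have h3 := ler_wpM2l D20 (kernel_lip x x' a mu mu').
have h4 := ler_wpM2l beta_ge0 (le_trans h2 h3).
rewrite /action_value opprD addrACA -mulrBr (le_trans (ler_normD _ _))//.
rewrite normrM (ger0_norm beta_ge0).
by apply: le_trans (lerD h1 h4) _; lra.
Qed.

(** [Omega] attains its extreme values on the compact simplex. [B] is chosen before [F], so the
    bound is uniform in time and state. *)
Lemma objective_bounded : exists B : R, forall F (M : R) u,
  (forall a, `|F a| <= M) ->
  `|objective Omega F u| <= B + M.
Proof.
have [u1 h1] := simplex_min hOmega_cont.
have [u2 h2] : exists u, forall v, - Omega u <= - Omega v.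
  by apply: simplex_min => v; exact: cvgN (@hOmega_cont v).
exists (`|Omega u1| + `|Omega u2|) => F M u FM.
rewrite (le_trans (ler_normD _ _))// lerD ?norm_mean_le//.
rewrite ler_norml; apply/andP; split.
  have := h1 u; have := ler_norm (- Omega u1); have := normr_ge0 (Omega u2).
  by rewrite normrN; lra.
have := h2 u; have := ler_norm (Omega u2); have := normr_ge0 (Omega u1); lra.
Qed.

(** * Dynamic programming against a fixed flow *)

Section Flow.
Variable mu : flow R X.

(** Time and state form one index, so that value functions are families to which the fixed point
    lemmas apply. *)
Definition bellman (W : nat * X -> R) (i : nat * X) : R :=
  min_value Omega (action_value (fun y => W (i.1.+1, y)) i.2 (mu i.1)).

Lemma bellman_lip W W' d : (forall i, `|W i - W' i| <= d) ->
  forall i, `|bellman W i - bellman W' i| <= beta * d.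
Proof.
move=> WW' [t x]; apply: (min_value_close hOmega_cont) => a.
exact: action_value_close.
Qed.

Definition is_value (W : nat * X -> R) : Prop :=
  bellman W = W /\ exists M, forall i, `|W i| <= M.

Lemma value_exists : exists W, is_value W.
Proof.
have [B hB] := objective_bounded; have [M hM] := cost_bounded.
have bd0 i : `|(fun=> 0) i - bellman (fun=> 0) i| <= B + M.
  case: i => t x; rewrite sub0r normrN; apply: hB => a.
  by rewrite /action_value big1 ?mulr0 ?addr0// => y _; rewrite mul0r.
have sep (x y : R) : `|x - y| <= 0 -> x = y.
  by rewrite normr_le0 subr_eq0 => /eqP.
have [W [WE [M' WM']]] := contraction_exists (@distrC R R)
  (fun x y z => ler_distD y x z) sep hbeta bellman_lip
  (@real_geometrically_complete R) bd0.
by exists W; split=> //; exists M' => i; have := WM' i; rewrite sub0r normrN.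
Qed.

Lemma value_unique W W' : is_value W -> is_value W' -> W = W'.
Proof.
move=> [WE [M WM]] [W'E [M' WM']].
apply: (contraction_unique (dist := fun x y : R => `|x - y|) _ hbeta
  bellman_lip (M := M + M')) => // [x y|i].
  by rewrite normr_le0 subr_eq0 => /eqP.
by rewrite (le_trans (ler_normB _ _))// lerD.
Qed.

Definition value : nat * X -> R := xget (fun=> 0) is_value.

Lemma valueP : is_value value.
Proof. by have [W hW] := value_exists; exact: (xgetPex _ (ex_intro _ W hW)). Qed.

Lemma value_osc t x x' : `|value (t, x) - value (t, x')| <= Lb.
Proof.
have [vE [M vM]] := valueP.
pose a (i : nat * X * X) := `|value i.1 - value (i.1.1, i.2)|.
(* The supremum runs over all times and pairs of states at once: oscillation [d] at time [s.+1]
   gives [L1 + beta * K1 / 2 * d] at time [s]. *)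
apply: (@affine_bound _ _ a (M + M) L1 (beta * K1 / 2) _ _ _ (t, x, x')) => //.
  by move=> i; rewrite (le_trans (ler_normB _ _))// lerD.
move=> d ad [[s y] y']; rewrite /a/= -vE.
have d0 : 0 <= d := le_trans (normr_ge0 _) (ad (s, y, y')).
apply: (min_value_close hOmega_cont) => b.
have /action_value_lip : forall z z', `|value (s.+1, z) - value (s.+1, z')| <= d.
  by move=> z z'; exact: (ad (s.+1, z, z')).
move=> /(_ y y' (mu s) (mu s) b) /le_trans; apply.
rewrite dist_l1xx addr0 !mulrA ler_piMr//; last by case: (y != y').
by rewrite addr_ge0// !mulr_ge0.
Qed.

Definition best_response t x : simplex R A :=
  minimizer Omega (action_value (fun y => value (t.+1, y)) x (mu t)).

Lemma best_response_osc t x x' :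
  dist_l1 (best_response t x) (best_response t x') <= Lb / rho.
Proof.
apply: (minimizer_lip hrho hOmega_cont hOmega_conv) => a.
apply: le_trans (action_value_lip _ _ _ _ _ (value_osc t.+1)) _.
rewrite Lbar_fixed dist_l1xx addr0 ler_piMr ?Lbar_ge0//.
by case: (x != x').
Qed.

Definition next_measure t : simplex R X :=
  mixture (fun x => mean_kernel p x (best_response t x) (mu t)) (mu t).

End Flow.

(** * Dependence of values, best responses and next measures on the flow *)

Section TwoFlows.
Variables (mu mu' : flow R X) (d : R).
Hypothesis mu_close : forall t, dist_l1 (mu t) (mu' t) <= d.

Let d_ge0 : 0 <= d. Proof. exact: le_trans (dist_l1_ge0 _ _) (mu_close 0). Qed.

Let action_value_flow e t x a :
  (forall i, `|value mu i - value mu' i| <= e) ->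
  `|action_value (fun y => value mu (t.+1, y)) x (mu t) a
    - action_value (fun y => value mu' (t.+1, y)) x (mu' t) a|
  <= Lb * d + beta * e.
Proof.
move=> he.
(* Changing the next values first costs [beta * e]; changing the measure then costs [Lb * d], by the
   oscillation bound on [value mu']. *)
pose mixed := action_value (fun y => value mu' (t.+1, y)) x (mu t) a.
rewrite (le_trans (ler_distD mixed _ _))//.
rewrite addrC lerD//; last exact: action_value_close.
apply: le_trans (action_value_lip _ _ _ _ _ (value_osc mu' t.+1)) _.
by rewrite Lbar_fixed eqxx add0r ler_wpM2l ?Lbar_ge0.
Qed.

Lemma value_close i : `|value mu i - value mu' i| <= Lb * d / (1 - beta).
Proof.
have [vE [M vM]] := valueP mu; have [vE' [M' vM']] := valueP mu'.
apply: (@affine_bound _ _ (fun i => `|value mu i - value mu' i|) (M + M')) => //.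
  by move=> j; rewrite (le_trans (ler_normB _ _))// lerD.
move=> e he [t x]; rewrite -vE -vE'.
by apply: (min_value_close hOmega_cont) => a; exact: action_value_flow.
Qed.

Lemma best_response_close t x :
  dist_l1 (best_response mu t x) (best_response mu' t x)
    <= Lb / (rho * (1 - beta)) * d.
Proof.
have -> : Lb / (rho * (1 - beta)) * d =
    (Lb * d + beta * (Lb * d / (1 - beta))) / rho.
  by field; rewrite rho_neq0.
apply: (minimizer_lip hrho hOmega_cont hOmega_conv) => a.
by apply: action_value_flow; exact: value_close.
Qed.

(** The kernel is changed first, with [mu t] as weights, then the weights. The second change profits
    from the halved oscillation of the kernel in the state. *)
Lemma next_measure_lip t : dist_l1 (next_measure mu t) (next_measure mu' t)
  <= (Kbar beta L1 K1 rho + Lb * K1 / (rho * (1 - beta))) * d.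
Proof.
apply: le_trans (dist_l1_triangle _ (mixture
  (fun x => mean_kernel p x (best_response mu' t x) (mu' t)) (mu t)) _) _.
have h1 : forall x, dist_l1 (mean_kernel p x (best_response mu t x) (mu t))
    (mean_kernel p x (best_response mu' t x) (mu' t))
    <= K1 * (Lb / (rho * (1 - beta)) * d + d).
  move=> x; apply: le_trans (mean_kernel_lip _ _ _ _ _ _) _.
  by rewrite eqxx add0r ler_wpM2l// lerD// best_response_close.
have h2 : forall x x', dist_l1 (mean_kernel p x (best_response mu' t x) (mu' t))
    (mean_kernel p x' (best_response mu' t x') (mu' t)) <= K1 * (1 + Lb / rho).
  move=> x x'; apply: le_trans (mean_kernel_lip _ _ _ _ _ _) _.
  rewrite dist_l1xx addr0 ler_wpM2l// lerD ?best_response_osc//.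
  by case: (x != x').
apply: le_trans (lerD (mixture_lipl _ h1) (mixture_lipr _ _ h2)) _.
have D0 : 0 <= K1 * (1 + Lb / rho) / 2.
  by rewrite divr_ge0// mulr_ge0// addr_ge0// divr_ge0 ?Lbar_ge0// ltW.
apply: le_trans (lerD (lexx _) (ler_wpM2l D0 (mu_close t))) _.
(* The weight change yields [Lb / rho]; enlarging it to [q = Lb / (rho * (1 - beta))] gives the
   total [3 * K1 / 2 * (1 + q)], the stated constant. *)
have : Lb / rho <= Lb / (rho * (1 - beta)).
  rewrite ler_wpM2l ?Lbar_ge0// lef_pV2 ?posrE ?mulr_gt0 ?subr_gt0//.
  by rewrite ler_piMr ?(ltW hrho)//; move: beta_ge0; lra.
move=> /(ler_wpM2l (mulr_ge0 hK1 d_ge0)) h.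
have -> : (Kbar beta L1 K1 rho + Lb * K1 / (rho * (1 - beta))) * d =
  K1 * (Lb / (rho * (1 - beta)) * d + d) + K1 * d / 2
   + K1 * d * (Lb / (rho * (1 - beta))) / 2.
  rewrite /Kbar; by set l := Lb; field; rewrite beta_neq1.
by move: h; set q := Lb / (rho * _); set r := Lb / rho => h; lra.
Qed.

End TwoFlows.

(** Uniqueness of values and of minimizers removes the existential [Q] and [f]: the policy is a
    function of the flow. *)
Lemma is_mfeP mu0 pi mu : is_mfe beta c p Omega mu0 pi mu <->
  [/\ mu 0%N = mu0,
      pi = (fun t x => \d_(best_response mu t x : action R A))
    & forall t, mu t.+1 = next_measure mu t].
Proof.
split.
  case=> mu00 [Q [f [[[M QM] [V [Vmin QE]]] fmin piE muE]]].
  have QE' t x u : Q t x u = objective Omega (action_value (V t.+1) x (mu t)) u.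
    by rewrite QE objective_action_value.
  (* [V] is bounded because its entries are attained values of the bounded [Q], so [value_unique]
     applies. *)
  have VE : (fun i => V i.1 i.2) = value mu.
    apply: (@value_unique mu); last exact: valueP; split.
      apply/funext => -[t x]; have [[u _ uV] Vle] := Vmin t x.
      apply/eqP; rewrite eq_le; apply/andP; split.
        by rewrite /= -uV QE'; exact: minimizerP.
      by apply: Vle; exists (minimizer Omega (action_value (V t.+1) x (mu t))).
    by exists M => -[t x]/=; have [[u _ <-] _] := Vmin t x.
  have fE t x : f t x = best_response mu t x.
    apply: (minimizer_unique hrho hOmega_cont hOmega_conv) => v.
    by have := fmin t x v; rewrite !QE' -VE.
  split=> // [|t].
    by apply/funext => t; apply/funext => x; rewrite piE fE.
  by rewrite muE; congr mixture; apply/funext => x; rewrite fE.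
case=> mu00 -> muE; split=> //.
pose Q t x u :=
  objective Omega (action_value (fun y => value mu (t.+1, y)) x (mu t)) u.
have [vE [M vM]] := valueP mu.
exists Q, (best_response mu); split=> // [|t x u]; last exact: minimizerP.
have [B hB] := objective_bounded; have [C hC] := cost_bounded.
split.
  exists (B + (C + beta * M)) => t x u; apply: hB => a.
  rewrite (le_trans (ler_normD _ _))// lerD// normrM (ger0_norm beta_ge0).
  by rewrite ler_wpM2l//; exact: norm_mean_le.
exists (fun t x => value mu (t, x)); split=> [t y|t x u].
  rewrite -vE; split; first by exists (best_response mu t y).
  by move=> _ [u _ <-]; exact: minimizerP.
exact: objective_action_value.
Qed.

(** For a constant flow, the time shift of [value] by [t] is again a bounded solution of the Bellman
    equation, hence equals [value]. *)
Lemma best_response_const mu t x :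
  best_response (fun=> mu) t x = best_response (fun=> mu) 0 x.
Proof.
rewrite /best_response; congr (minimizer _ (action_value _ _ _)).
have [vE [M vM]] := valueP (fun=> mu).
suff E : (fun i => value (fun=> mu) (t + i.1, i.2)%N) = value (fun=> mu).
  by apply/funext => y; rewrite -[RHS](congr1 (@^~ (1%N, y)) E)/= addn1.
apply: (@value_unique (fun=> mu)); last exact: valueP.
split; last by exists M => i; exact: vM.
apply/funext => -[s y] /=; rewrite -[RHS](congr1 (@^~ ((t + s)%N, y)) vE)/=.
by rewrite /bellman/= addnS.
Qed.

Lemma is_stationary_mfeP pi mu : is_stationary_mfe beta c p Omega pi mu <->
  pi = (fun x => \d_(best_response (fun=> mu) 0 x : action R A))
  /\ next_measure (fun=> mu) 0 = mu.
Proof.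
rewrite /is_stationary_mfe is_mfeP; split.
  by case=> _ piE muE; split; [exact: (congr1 (@^~ 0%N) piE) | rewrite -muE].
case=> -> muE; split=> // [|t].
  by apply/funext => t; apply/funext => x; rewrite best_response_const.
rewrite -[LHS]muE; congr mixture; apply/funext => x.
by rewrite [in RHS]best_response_const.
Qed.

End MeanFieldGame.

Theorem theorem4 (R : realType) (X A : pfinType)
  (beta L1 K1 rho : R)
  (c : X -> A -> simplex R X -> R)
  (p : X -> A -> simplex R X -> simplex R X)
  (Omega : simplex R A -> R)
  (hbeta : 0 <= beta < 1)
  (hL1 : 0 <= L1) (hK1 : 0 <= K1) (hbetaK1 : beta * K1 < 2)
  (hc : forall x x' a a' mu mu',
     `|c x a mu - c x' a' mu'| <= L1 * dist_xam x x' a a' mu mu')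
  (hp : forall x x' a a' mu mu',
     dist_tv (p x a mu) (p x' a' mu') <= K1 / 2 * dist_xam x x' a a' mu mu')
  (hrho : 0 < rho)
  (hOmega_cont : continuous Omega)
  (hOmega_conv : strongly_convex rho Omega)
  (hcontr : Kbar beta L1 K1 rho
            + Lbar beta L1 K1 * K1 / (rho * (1 - beta)) < 1) :
  (forall mu0 : simplex R X,
     exists! e : (nat -> policy R X A) * flow R X,
       is_mfe beta c p Omega mu0 e.1 e.2) /\
  (exists! e : policy R X A * simplex R X,
     is_stationary_mfe beta c p Omega e.1 e.2).
Proof.
have k_lt1 := hcontr.
set k := _ + _ in k_lt1.
have k_ge0 : 0 <= k.
  have Lb_ge0 := Lbar_ge0 hL1 hbetaK1; have rho_ge0 := ltW hrho.
  have b_ge0 : 0 <= 1 - beta by case/andP: hbeta => _ /ltW; rewrite subr_ge0.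
  have Kbar_ge0 : 0 <= Kbar beta L1 K1 rho.
    by rewrite addr_ge0// divr_ge0// mulr_ge0// mulr_ge0.
  by rewrite /k addr_ge0// divr_ge0// mulr_ge0.
have k01 : 0 <= k < 1 by rewrite k_ge0.
pose br := best_response beta c p Omega.
pose nxt := next_measure beta c p Omega.
have nxt_lip (mu mu' : flow R X) d : (forall t, dist_l1 (mu t) (mu' t) <= d) ->
    forall t, dist_l1 (nxt mu t) (nxt mu' t) <= k * d.
  exact: (next_measure_lip hbeta hL1 hK1 hbetaK1 hc hp hrho hOmega_cont hOmega_conv).
have mfeP := is_mfeP p hbeta hL1 hc hrho hOmega_cont hOmega_conv.
have smfeP := is_stationary_mfeP p hbeta hL1 hc hrho hOmega_cont hOmega_conv.
pose resp (mu : flow R X) : nat -> policy R X A :=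
  fun t x => \d_(br mu t x : action R A).
split.
  move=> mu0.
  (* Placing [mu0] at time [0] makes the fixed points of [H] exactly the equilibrium flows of
     [mfeP]. *)
  pose H (mu : flow R X) : flow R X := fun t => if t is s.+1 then nxt mu s else mu0.
  have H_lip mu mu' d : (forall t, dist_l1 (mu t) (mu' t) <= d) ->
      forall t, dist_l1 (H mu t) (H mu' t) <= k * d.
    move=> md [|t]; last exact: nxt_lip.
    by rewrite dist_l1xx mulr_ge0// (le_trans (dist_l1_ge0 _ _) (md 0%N)).
  have [mu [muE _]] := contraction_exists (@dist_l1_sym R X) (@dist_l1_triangle R X)
    (@dist_l1_sep R X) k01 H_lip (@simplex_geometrically_complete R X)
    (fun t => dist_l1_le2 ((fun=> mu0) t) (H (fun=> mu0) t)).
  (* The policy is already determined by the flow, so only the flow remains to be compared. *)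
  exists (resp mu, mu); split=> [|[pi mu'] /mfeP[/= mu'0 -> mu'S]].
    by apply/mfeP; split=> // [|t]; rewrite -[in LHS]muE.
  have mu'E : H mu' = mu' by apply/funext => -[|t] /=; rewrite ?mu'0 ?mu'S.
  suff -> : mu' = mu by [].
  exact: (contraction_unique (@dist_l1_sep R X) k01 H_lip
    (fun t => dist_l1_le2 _ _) mu'E muE).
(* A single measure is a family indexed by [unit]; extending it to a constant flow preserves
   distance bounds, so [nxt_lip] applies. *)
pose H (nu : unit -> simplex R X) (_ : unit) : simplex R X := nxt (fun=> nu tt) 0%N.
have H_lip nu nu' d : (forall i, dist_l1 (nu i) (nu' i) <= d) ->
    forall i, dist_l1 (H nu i) (H nu' i) <= k * d.
  by move=> nd i; apply: nxt_lip => _; exact: nd.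
have [nu [nuE _]] := contraction_exists (@dist_l1_sym R X) (@dist_l1_triangle R X)
  (@dist_l1_sep R X) k01 H_lip (@simplex_geometrically_complete R X)
  (fun i => dist_l1_le2 ((fun=> point) i) (H (fun=> point) i)).
exists (resp (fun=> nu tt) 0%N, nu tt); split=> [|[pi mu] /smfeP[/= -> muE]].
  by apply/smfeP; split=> //; exact: (congr1 (@^~ tt) nuE).
suff -> : mu = nu tt by [].
have muE' : H (fun=> mu) = fun=> mu by apply/funext => i; exact: muE.
have := contraction_unique (@dist_l1_sep R X) k01 H_lip
  (fun t => dist_l1_le2 _ _) muE' nuE.
by move=> /(congr1 (@^~ tt)).
Qed.
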